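(* Let $\mathbb{K}$ be a countably infinite field and let $n_1,\ldots,n_r$ be non-zero integers, not divisible by the characteristic of $\mathbb{K}$. Suppose that the set $I=\{i=1,\ldots,r : n_i>0\}$ is non-empty. Then, for every double Følner sequence $(F_k)$ in $(\mathbb{K},+)$, all $\xi_1,\ldots,\xi_r\in\widehat{\mathbb{K}}$ satisfying $\xi_i\neq 1$ for all $i\in I$, and every multiplicative unitary character $\eta$ on $\mathbb{K}^*$, we have $$\lim_{k\to\infty}\frac{1}{|F_k|}\sum_{a\in F_k\setminus\{0\}}\eta(a)\,\xi_1(a^{n_1})\cdots\xi_r(a^{n_r})=0.$$
   Context: $\widehat{\mathbb{K}}=\operatorname{Hom}((\mathbb{K},+),\mathbb{S}^1)$ is the character group of the discrete additive group of $\mathbb{K}$, with trivial character $1$. A multiplicative unitary character on $\mathbb{K}^*$ is a homomorphism $\eta:\mathbb{K}^*\to\mathbb{S}^1$. The condition of not being divisible by the characteristic is vacuous if $\operatorname{char}(\mathbb{K})=0$. A double Følner sequence in $\mathbb{K}$ is a sequence $(F_k)$ of non-empty finite subsets of $\mathbb{K}$ that is asymptotically invariant under both addition and multiplication: $|F_k \cap (F_k + b)|/|F_k| \to 1$ for every $b \in \mathbb{K}$ and $|F_k\cap aF_k|/|F_k| \to 1$ for every $a \in \mathbb{K}^*$.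
   Formalization: The positive integers among n_1,…,n_r are assumed pairwise distinct; without this the claim fails (e.g. r=2, n_1=n_2=1, ξ_2 the conjugate of a nontrivial ξ_1, η=1, where the limit is 1). *)

(* Defs.v *)
From HB Require Import structures.
From mathcomp Require Import all_boot all_order all_algebra finmap.
From mathcomp Require Import complex.
From mathcomp Require Import all_classical all_reals all_analysis.
Import Order.TTheory GRing.Theory Num.Theory.
Import numFieldNormedType.Exports.

Set Implicit Arguments.
Unset Strict Implicit.
Unset Printing Implicit Defensive.

Local Open Scope classical_set_scope.
Local Open Scope ring_scope.

Definition unit_circle (R : realType) : set R[i] := [set z | `|z| = 1].

Definition additive_character (R : realType) (K : fieldType) : set (K -> R[i]) :=
  [set xi | (forall x, unit_circle (xi x)) /\
            (forall x y, xi (x + y) = xi x * xi y)].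

(* Total functions on K, of which only the restriction to K^* matters: the
   value at 0 is unconstrained. *)
Definition multiplicative_character (R : realType) (K : fieldType) :
    set (K -> R[i]) :=
  [set eta | (forall a, a != 0 -> unit_circle (eta a)) /\
             (forall a b, a != 0 -> b != 0 -> eta (a * b) = eta a * eta b)].

Definition double_Folner (R : realType) (K : fieldType) (F : nat -> {fset K}) :=
  [/\ forall k, F k != fset0%fset,
      forall b : K,
        (#|` (F k `&` [fset (x + b)%R | x in F k])%fset|%:R / #|` F k|%:R : R)
          @[k --> \oo] --> (1 : R)
    & forall a : K, a != 0 ->
        (#|` (F k `&` [fset (a * x)%R | x in F k])%fset|%:R / #|` F k|%:R : R)
          @[k --> \oo] --> (1 : R)].

(* Main.v *)
Require Import Defs.
From HB Require Import structures.
From mathcomp Require Import all_boot all_order all_algebra finmap.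
From mathcomp Require Import complex.
From mathcomp Require Import all_classical all_reals all_analysis.
From mathcomp Require Import ring zify.
Import Order.TTheory GRing.Theory Num.Theory.
Import numFieldNormedType.Exports.

Set Implicit Arguments.
Unset Strict Implicit.
Unset Printing Implicit Defensive.

Local Open Scope classical_set_scope.
Local Open Scope ring_scope.

(** The averages over a double Folner sequence are asymptotically invariant under
    the affine substitutions a -> c a + h with c <> 0. So the average of a bounded
    function f is close to the average of f (c (y) a + h (y)) over a and over any
    finite set of parameters y, whatever the functions c and h with c (y) <> 0. The
    proof chooses c and h such that, in y, almost all the phases are polynomial
    and the interesting one has a pole. Iterating the van der Corput inequality
    in y (differencing with generic shifts) then kills the polynomial phases
    and the factors depending on a alone or on y alone, whatever the
    characteristic, and cannot kill the pole. This principle consists of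
    [null_vdc] and [phase_form_twisted_vdc], and it is used twice.

    First, let n be the largest exponent. With a -> a / y the factor
    xi_i (a^(n_i)) becomes xi_i (a^(n_i) y^(-n_i)), polynomial in y when n_i < 0
    and polar when n_i > 0, and eta (a / y) is the product of a function of y
    and a function of a. So eta and the negative exponents
    disappear, and one is left with the product of the xi_i (v_i a^(n_i)) over
    n_i > 0, where v_i is a scalar, nonzero for the largest exponent.

    Second ([null_monomial_phase]), with a -> (1 + y^(n-1) a) / y, binomial
    expansion shows that the only nonconstant monomial in a whose coefficient is
    not polynomial in y is n a / y, coming from the top exponent n. What is left
    after differencing is the character xi_top (s n a) with s <> 0. Since n is
    invertible in K, it is a nontrivial additive character, whose averages tend
    to 0 by translation invariance ([null_additive_character]). *)

(** * Averages over finite sequences *)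

Section Mean.
Variable C : numClosedFieldType.

Definition mean (T : Type) (s : seq T) (f : T -> C) : C :=
  (size s)%:R^-1 * \sum_(x <- s) f x.

Section MeanTheory.
Variables (T : Type) (s : seq T).
Implicit Types f g : T -> C.

Lemma eq_mean f g : f =1 g -> mean s f = mean s g.
Proof. by move=> fg; congr (_ * _); apply: eq_bigr => x _; apply: fg. Qed.

Lemma meanD f g : mean s (fun x => f x + g x) = mean s f + mean s g.
Proof. by rewrite /mean big_split mulrDr. Qed.

Lemma meanZ c f : mean s (fun x => c * f x) = c * mean s f.
Proof. by rewrite /mean -mulr_sumr mulrCA. Qed.

Lemma meanB f g : mean s (fun x => f x - g x) = mean s f - mean s g.
Proof. by rewrite /mean sumrB mulrBr. Qed.

Lemma exchange_mean (U : Type) (t : seq U) (f : T -> U -> C) :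
  mean s (fun x => mean t (f x)) = mean t (fun y => mean s (f^~ y)).
Proof. by rewrite /mean -!mulr_sumr exchange_big mulrCA. Qed.

Lemma mean_allpairs (U : Type) (t : seq U) (V : Type) (h : T -> U -> V)
    (f : V -> C) :
  mean [seq h x y | x <- s, y <- t] f =
  mean s (fun x => mean t (fun y => f (h x y))).
Proof.
rewrite /mean size_allpairs big_allpairs_dep natrM invfM -mulr_sumr.
by rewrite mulrA.
Qed.

Lemma mean_conj f : (mean s f)^* = mean s (fun x => (f x)^*).
Proof. by rewrite /mean rmorphM fmorphV rmorph_nat rmorph_sum. Qed.

Lemma norm_mean f : `|mean s f| <= mean s (fun x => `|f x|).
Proof.
rewrite /mean normrM normfV normr_nat ler_wpM2l ?invr_ge0 //.
exact: ler_norm_sum.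
Qed.

Lemma ler_mean f g : (forall x, f x <= g x) -> mean s f <= mean s g.
Proof. by move=> fg; rewrite ler_wpM2l ?invr_ge0 // ler_sum. Qed.

Lemma mean_ge0 f : (forall x, 0 <= f x) -> 0 <= mean s f.
Proof. by move=> f0; rewrite mulr_ge0 ?invr_ge0 // sumr_ge0. Qed.

Lemma mean_nil f : s = [::] -> mean s f = 0.
Proof. by move->; rewrite /mean big_nil mulr0. Qed.

Lemma mean_cst c : s <> [::] -> mean s (fun=> c) = c.
Proof.
move=> s0; rewrite /mean big_const_seq count_predT iter_addr_0 -[c *+ _]mulr_natl.
by rewrite mulKf // pnatr_eq0; case: s s0.
Qed.

(** The difference of the two sides is the variance of f on s. *)
Lemma sqr_norm_mean f : `|mean s f| ^+ 2 <= mean s (fun x => `|f x| ^+ 2).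
Proof.
have [s0|s0] := pselect (s = [::]); first by rewrite !mean_nil ?normr0 ?expr0n.
set m := mean s f; rewrite -subr_ge0.
suff -> : mean s (fun x => `|f x| ^+ 2) - `|m| ^+ 2 =
          mean s (fun x => `|f x - m| ^+ 2).
  by apply: mean_ge0 => x; rewrite exprn_ge0.
rewrite (_ : mean s (fun x => `|f x - m| ^+ 2) =
  mean s (fun x => `|f x| ^+ 2 - m^* * f x - (m * (f x)^* - `|m| ^+ 2))).
  rewrite !meanB !meanZ -mean_conj mean_cst // -/m normCK.
  by rewrite [m^* * m]mulrC -expr2 normCK subrr subr0.
apply: eq_mean => x; rewrite !normCK rmorphB /= mulrBr !mulrBl opprB.
rewrite [m^* * f x]mulrC opprB. ring.
Qed.

End MeanTheory.

Lemma norm_mean_le (T : eqType) (s : seq T) (c : C) (f : T -> C) :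
  0 <= c -> (forall x, x \in s -> `|f x| <= c) -> `|mean s f| <= c.
Proof.
move=> c0 fc; have [->|s0] := eqVneq s [::].
  by rewrite mean_nil // normr0.
rewrite -[leRHS](mean_cst c (elimN eqP s0)); apply: (le_trans (norm_mean _ _)).
by rewrite ler_wpM2l ?invr_ge0 // big_seq [leRHS]big_seq ler_sum.
Qed.

(** The diagonal carries only a proportion 1 / #|s| of the pairs: this is what
    makes an average over a large set of shifts small. *)
Lemma norm_mean2_le (T : eqType) (s : seq T) (u : T -> T -> C) (e : C) :
    s != [::] -> uniq s -> 0 <= e -> (forall x, `|u x x| <= 1) ->
    (forall x y, x \in s -> y \in s -> x != y -> `|u x y| <= e) ->
  `|mean s (fun x => mean s (u x))| <= (size s)%:R^-1 + e.
Proof.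
move=> s0 us e0 u1 ue.
have sz : (size s)%:R != 0 :> C by rewrite pnatr_eq0 size_eq0.
have szp : 0 < (size s)%:R :> C by rewrite lt0r sz /= ler0n.
pose c : C := (size s)%:R^-1 + e.
have row x : x \in s -> `|mean s (u x)| <= c.
  move=> xs; rewrite /mean normrM normfV normr_nat ler_pdivrMl //.
  rewrite (bigD1_seq x) //= mulrDr mulfV //.
  apply: (le_trans (ler_normD _ _)); apply: lerD; first exact: u1.
  apply: (le_trans (ler_norm_sum _ _ _)).
  apply: (@le_trans _ _ (\sum_(i <- s) e)).
    rewrite big_mkcond /= big_seq [leRHS]big_seq ler_sum // => y ys.
    by case: ifP => // xy; apply: ue; rewrite // eq_sym.
  by rewrite big_const_seq count_predT iter_addr_0 -[e *+ _]mulr_natl.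
rewrite {1}/mean normrM normfV normr_nat ler_pdivrMl //.
apply: (le_trans (ler_norm_sum _ _ _)); rewrite big_seq.
apply: (@le_trans _ _ (\sum_(i <- s) c)); last first.
  by rewrite big_const_seq count_predT iter_addr_0 -[c *+ _]mulr_natl.
by rewrite [leRHS]big_seq ler_sum.
Qed.

(** Applying Cauchy-Schwarz to the average over a and y alone leaves the square
    of the average over the shifts t, whose expansion pairs G with a shifted
    copy of itself. *)
Lemma van_der_Corput (T K : Type) (op : K -> K -> K) (s : seq T) (Y X : seq K)
    (G : K -> T -> C) :
  `|mean s (fun a => mean [seq op y t | y <- Y, t <- X] (G^~ a))| ^+ 2 <=
  `|mean X (fun t => mean X (fun t' => mean s (fun a => mean Y (fun y =>
      G (op y t) a * (G (op y t') a)^*))))|.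
Proof.
apply: (le_trans (sqr_norm_mean _ _)).
apply: (@le_trans _ _ (mean s (fun a => mean Y (fun y =>
   `|mean X (fun t => G (op y t) a)| ^+ 2)))).
  by apply: ler_mean => a; rewrite mean_allpairs; apply: sqr_norm_mean.
suff <- : mean s (fun a => mean Y (fun y =>
   `|mean X (fun t => G (op y t) a)| ^+ 2)) =
   mean X (fun t => mean X (fun t' => mean s (fun a => mean Y (fun y =>
      G (op y t) a * (G (op y t') a)^*)))).
  apply/real_ler_norm/ger0_real; apply: mean_ge0 => a; apply: mean_ge0 => y.
  by rewrite exprn_ge0.
have sq a y : `|mean X (fun t => G (op y t) a)| ^+ 2 =
   mean X (fun t => mean X (fun t' => G (op y t) a * (G (op y t') a)^*)).
  rewrite normCK mean_conj mulrC -meanZ; apply: eq_mean => t.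
  by rewrite mulrC -meanZ.
rewrite (eq_mean _ (fun a => eq_mean _ (sq a))).
rewrite (eq_mean _ (fun a => exchange_mean _ _ _)) exchange_mean.
apply: eq_mean => t; rewrite (eq_mean _ (fun a => exchange_mean _ _ _)).
by rewrite exchange_mean.
Qed.

End Mean.

(** * Generic points of an infinite field *)

Section GenericPoints.
Variable K : fieldType.
Hypothesis K_infinite : infinite_set [set: K].

Lemma exists_nonroot (e : {poly K}) : e != 0 -> exists y, e.[y] != 0.
Proof.
move=> e0; apply: contrapT => /forallNP eN.
have er y : root e y by apply/negP => /negP ey; apply: (eN y).
have [A _ sA] := infinite_set_fset (size e) K_infinite.
have := max_poly_roots e0 (introT allP (fun y _ => er y)) (fset_uniq A).
by rewrite ltnNge sA.
Qed.

Lemma comp_XaddC_neq0 (e : {poly K}) c : e != 0 -> e \Po ('X + c%:P) != 0.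
Proof. by move=> e0; rewrite comp_poly2_eq0 // size_XaddC. Qed.

(** Greedy choice: each new point has to avoid the roots of finitely many
    nonzero polynomials determined by the points already chosen. *)
Lemma generic_differences (e : {poly K}) n : e != 0 ->
  exists X : seq K, [/\ size X = n, uniq X &
    forall t t', t \in X -> t' \in X -> t != t' -> e.[t' - t] != 0].
Proof.
move=> e0; elim: n => [|n [X [sX uX eX]]]; first by exists [::].
have [|z] := @exists_nonroot (\prod_(x <- X)
    (('X - x%:P) * (e \Po ('X - x%:P)) * (e \Po (x%:P - 'X)))).
  rewrite prodf_seq_neq0; apply/allP => x _ /=.
  rewrite !mulf_neq0 ?polyXsubC_eq0 // comp_poly2_eq0 ?size_XsubC //.
  by rewrite -opprB size_polyN size_XsubC.
rewrite horner_prod prodf_seq_neq0 => /allP zX.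
have {}zX x : x \in X -> [/\ z != x, e.[z - x] != 0 & e.[x - z] != 0].
  move=> /zX /=; rewrite !hornerM !horner_comp !hornerE !mulf_eq0 !negb_or.
  by rewrite subr_eq0 => /andP[/andP[]].
exists (z :: X); split => /=; first by rewrite sX.
  by rewrite uX andbT; apply/negP => /zX[]; rewrite eqxx.
move=> t t'; rewrite !inE => /predU1P[->|tX] /predU1P[->|t'X] tt'.
- by rewrite eqxx in tt'.
- by have [] := zX _ t'X.
- by have [] := zX _ tX.
- exact: eX.
Qed.

End GenericPoints.

(** * Iterated van der Corput differencing *)

Lemma near_all_seq (T : Type) (F : set_system T) (I : eqType) (s : seq I)
    (P : I -> T -> Prop) : Filter F ->
  (forall i, i \in s -> \forall x \near F, P i x) ->
  \forall x \near F, forall i, i \in s -> P i x.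
Proof.
move=> FF; elim: s => [|i s IH] H; first by apply: nearW => x j.
have Hi : \forall x \near F, P i x by apply: H; rewrite inE eqxx.
have Hs : \forall x \near F, forall j, j \in s -> P j x.
  by apply: IH => j js; apply: H; rewrite inE js orbT.
apply: filterS2 Hi Hs => x xi xs j; rewrite inE => /predU1P[->//|]; exact: xs.
Qed.

Lemma complex_archimedean (R : realType) (e : R[i]) :
  0 < e -> exists n, n.+1%:R^-1 <= e.
Proof.
move=> e0; have er : (complex.Re e)%:C%C = e by apply/RRe_real/ger0_real/ltW.
have re0 : 0 < complex.Re e by rewrite -ltcR er.
have [n ne] := ltr_add_invr re0; exists n; rewrite -er.
rewrite -(rmorph_nat (real_complex R)) -fmorphV lecR.
by rewrite add0r in ne; exact: ltW.
Qed.

Section Folner.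
Variables (R : realType) (K : fieldType) (F : nat -> {fset K}).
Local Notation C := R[i].

Definition null (f : K -> C) :=
  forall e : C, 0 < e -> \forall k \near \oo, `|mean (F k) f| <= e.

Lemma eq_null f g : f =1 g -> null f -> null g.
Proof. by move=> /funext ->. Qed.

Lemma nullD f g : null f -> null g -> null (fun a => f a + g a).
Proof.
move=> nf ng e e0; have e20 : 0 < e / 2 by rewrite divr_gt0.
apply: filterS2 (nf _ e20) (ng _ e20) => k fk gk.
by rewrite meanD (le_trans (ler_normD _ _)) // [leRHS]splitr lerD.
Qed.

Lemma nullZ (c : C) f : null f -> null (fun a => c * f a).
Proof.
move=> nf e e0; have c0 : 0 < `|c| + 1 by rewrite ltr_wpDl.
have ec : 0 < e / (`|c| + 1) by rewrite divr_gt0.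
apply: filterS (nf _ ec) => k; rewrite meanZ ler_pdivlMr //.
move=> /(le_trans _); apply.
by rewrite normrM mulrC ler_wpM2l // lerDl.
Qed.

(** The hypothesis under which d applications of the van der Corput inequality
    make averages of G over y small. Genericity is expressed as the nonvanishing
    of a nonzero polynomial: such conditions are stable under finite conjunction
    (product) and translation (composition with 'X + t), and are satisfiable in
    an infinite field. *)
Fixpoint vdc_null (d : nat) (G : K -> K -> C) : Prop :=
  if d is d'.+1 then
    exists2 e : {poly K}, e != 0 & forall t t', e.[t' - t] != 0 ->
      vdc_null d' (fun y a => G (y + t) a * (G (y + t') a)^*)
  else exists2 e : {poly K}, e != 0 & forall y, e.[y] != 0 -> null (G y).

Hypothesis K_infinite : infinite_set [set: K].

(** Iterated van der Corput. The induction is carried out for a finite family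
    of functions at once, because one step replaces G by all the products
    G (y + t) conj(G (y + t')), with t and t' in a finite set X of shifts, and a
    single set of parameters Y has to serve all of them. *)
Lemma vdc_null_small_means d (I : finType) (P : pred I) (G : I -> K -> K -> C) :
    (forall i y a, `|G i y a| <= 1) -> (forall i, P i -> vdc_null d (G i)) ->
    forall (e : {poly K}) (eps : C), e != 0 -> 0 < eps ->
  exists Y : seq K, [/\ Y <> [::], forall y, y \in Y -> e.[y] != 0 &
    forall i, P i -> \forall k \near \oo,
      `|mean (F k) (fun a => mean Y (fun y => G i y a))| <= eps].
Proof.
elim: d I P G => [|d IH] I P G G1 Gv e eps e0 eps0.
  have /fin_all_exists[E EP] (i : I) : exists e : {poly K},
      e != 0 /\ (P i -> forall y, e.[y] != 0 -> null (G i y)).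
    case: (boolP (P i)) => [/Gv[e' e'0 H]|_]; first by exists e'.
    by exists 1; split; rewrite ?oner_eq0.
  have [|y] := @exists_nonroot _ K_infinite (e * \prod_i E i).
    by rewrite mulf_neq0 //; apply/prodf_neq0 => i _; have [] := EP i.
  rewrite hornerM horner_prod mulf_eq0 negb_or => /andP[ey /prodf_neq0 Ey].
  exists [:: y]; split=> // [z|i Pi]; first by rewrite inE => /eqP ->.
  have [_ /(_ Pi _ (Ey i isT)) /(_ _ eps0)] := EP i.
  apply: filterS => k; congr (`|_| <= _); apply: eq_mean => a.
  by rewrite /mean big_seq1 invr1 mul1r.
have /fin_all_exists[E EP] (i : I) : exists e : {poly K},
    e != 0 /\ (P i -> forall t t', e.[t' - t] != 0 ->
      vdc_null d (fun y a => G i (y + t) a * (G i (y + t') a)^*)).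
  case: (boolP (P i)) => [/Gv[e' e'0 H]|_]; first by exists e'.
  by exists 1; split; rewrite ?oner_eq0.
have e20 : 0 < eps ^+ 2 / 2 by rewrite divr_gt0 ?exprn_gt0.
have [n ne] := complex_archimedean e20.
have [X [sX uX EX]] := @generic_differences _ K_infinite (\prod_i E i) n.+1
   (introT (prodf_neq0 _ _) (fun i _ => (EP i).1)).
have XI (a : 'I_n.+1) : X`_a \in X by rewrite mem_nth // sX.
(* Pairs of equal shifts are excluded from the family: they are not generic,
   and contribute at most 1 / #|X|. *)
pose G' (j : I * ('I_n.+1 * 'I_n.+1)) y a :=
  G j.1 (y + X`_j.2.1) a * (G j.1 (y + X`_j.2.2) a)^*.
have [||||Y [Y0 eY GY]] := IH _ (fun j => P j.1 && (j.2.1 != j.2.2)) G' _ _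
   (\prod_(x <- X) (e \Po ('X + x%:P))) (eps ^+ 2 / 2).
- by move=> j y a; rewrite normrM norm_conjC mulr_ile1.
- move=> [i [a b]] /andP[/= Pi ab]; have [_ /(_ Pi)] := EP i; apply.
  have := EX _ _ (XI a) (XI b); rewrite nth_uniq ?sX // => /(_ ab).
  by rewrite horner_prod => /prodf_neq0 /(_ i isT).
- by rewrite prodf_seq_neq0; apply/allP => x _; rewrite comp_XaddC_neq0.
- exact: e20.
exists [seq y + t | y <- Y, t <- X]; split.
- by case: (Y) Y0 => // y Y' _; case: (X) sX.
- move=> _ /allpairsP[[y t] /= [yY tX ->]]; have := eY _ yY.
  rewrite horner_prod prodf_seq_neq0 => /allP /(_ _ tX) /=.
  by rewrite horner_comp !hornerE.
move=> i Pi.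
have : \forall k \near \oo, forall ab : 'I_n.+1 * 'I_n.+1, ab.1 != ab.2 ->
    `|mean (F k) (fun a => mean Y (fun y => G' (i, ab) y a))| <= eps ^+ 2 / 2.
  apply: filter_forall => ab; case: (eqVneq ab.1 ab.2) => [_|nab].
    exact: nearW.
  by apply: filterS (GY (i, ab) _) => //=; rewrite Pi.
apply: filterS => k small.
rewrite -(@ler_pXn2r _ 2) ?nnegrE ?normr_ge0 ?(ltW eps0) //.
apply: (le_trans (van_der_Corput _ _ _ _ _)).
apply: (@le_trans _ _ ((size X)%:R^-1 + eps ^+ 2 / 2)); last first.
  by rewrite sX [leRHS]splitr lerD2r.
apply: norm_mean2_le; rewrite ?(ltW e20) //; first by case: (X) sX.
  move=> t; apply: norm_mean_le => // a _; apply: norm_mean_le => // y _.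
  by rewrite normrM norm_conjC mulr_ile1.
move=> t t' tX t'X tt'.
have it : (index t X < n.+1)%N by rewrite -sX index_mem.
have it' : (index t' X < n.+1)%N by rewrite -sX index_mem.
have := small (Ordinal it, Ordinal it'); rewrite /G' /= !nth_index //; apply.
by apply: contra tt' => /eqP [/(congr1 (nth 0 X))]; rewrite !nth_index // => ->.
Qed.

End Folner.

(** * Affine invariance *)

(** The two sums cancel on the intersection of A with its image. *)
Lemma norm_sum_injection (C : numClosedFieldType) (K : choiceType)
    (A : {fset K}) (s : K -> K) (f : K -> C) :
    injective s -> (forall a, `|f a| <= 1) ->
  `|\sum_(a <- A) f (s a) - \sum_(a <- A) f a| <=
  2 * (#|` A|%:R - #|` (A `&` [fset s a | a in A])%fset|%:R).
Proof.
move=> s_inj f1; set B := [fset s a | a in A]%fset.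
have cardB : #|` B| = #|` A| by rewrite card_imfset.
have split_sum (S T : {fset K}) : \sum_(a <- S) f a =
    \sum_(a <- (S `&` T)%fset) f a + \sum_(a <- (S `\` T)%fset) f a.
  rewrite (big_fsetID _ (mem T)) /=; congr (_ + _); apply: congr_big => //.
    by congr (enum_fset _); apply/fsetP => x; rewrite !inE.
  by congr (enum_fset _); apply/fsetP => x; rewrite !inE andbC.
have norm_sum (S : {fset K}) : `|\sum_(a <- S) f a| <= #|` S|%:R.
  apply: (le_trans (ler_norm_sum _ _ _)).
  apply: (@le_trans _ _ (\sum_(a <- S) 1)); first exact: ler_sum.
  by rewrite big_const_seq count_predT iter_addr_0.
have <- : \sum_(b <- B) f b = \sum_(a <- A) f (s a).
  by rewrite big_imfset //= => x y _ _; apply: s_inj.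
rewrite (split_sum B A) (split_sum A B) fsetIC opprD addrACA subrr add0r.
apply: (le_trans (ler_normB _ _)); rewrite mulrDl mul1r.
apply: lerD; apply: (le_trans (norm_sum _));
  rewrite cardfsD natrB ?fsubset_leq_card ?fsubsetIl //.
by rewrite fsetIC cardB.
Qed.

Section Invariance.
Variables (R : realType) (K : fieldType) (F : nat -> {fset K}).
Local Notation C := R[i].
Hypothesis K_infinite : infinite_set [set: K].
Hypothesis F_Folner : double_Folner R F.

Lemma null_injection (s : K -> K) (f : K -> C) :
    injective s -> (forall a, `|f a| <= 1) ->
    (#|` (F k `&` [fset s a | a in F k])%fset|%:R / #|` F k|%:R : R)
      @[k --> \oo] --> (1 : R) ->
  null F (fun a => f (s a) - f a).
Proof.
move=> s_inj f1 /cvgrPdist_le sF e e0.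
have er : (complex.Re e)%:C%C = e by apply/RRe_real/ger0_real/ltW.
have re0 : 0 < complex.Re e by rewrite -ltcR er.
have re20 : 0 < complex.Re e / 2 by rewrite divr_gt0.
apply: filterS (sF _ re20) => k; set N : R := _ / _ => Nk.
have F0 : #|` F k|%:R != 0 :> C.
  by have [F0 _ _] := F_Folner; rewrite pnatr_eq0 cardfs_eq0.
have F0' : #|` F k|%:R != 0 :> R.
  by have [Fn _ _] := F_Folner; rewrite pnatr_eq0 cardfs_eq0.
rewrite meanB /mean -mulrBr normrM normfV normr_nat ler_pdivrMl; last first.
  by rewrite lt0r F0 /=.
apply: (le_trans (norm_sum_injection _ s_inj f1)).
rewrite -er -!(rmorph_nat (real_complex R)) -rmorphB -!rmorphM lecR.
have F0p : 0 < #|` F k|%:R :> R by rewrite lt0r F0' /=.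
have := ler_norm (1 - N) => /le_trans /(_ Nk).
rewrite -(ler_pM2r F0p) -(ler_pM2l (ltr0Sn R 1)) mulrBl mul1r divfK //.
move=> /le_trans; apply; rewrite mulrA mulrCA mulfV ?pnatr_eq0 // mulr1.
by rewrite mulrC.
Qed.

Lemma null_affine (c h : K) (f : K -> C) : c != 0 -> (forall a, `|f a| <= 1) ->
  null F (fun a => f (c * a + h) - f a).
Proof.
move=> c0 f1; have [_ addF mulF] := F_Folner.
have add : null F (fun a => f (a + h) - f a).
  by apply: null_injection f1 (addF h); apply: addIr.
have mul : null F (fun a => f (c * a + h) - f (a + h)).
  apply: (null_injection (f := fun a => f (a + h))) (mulF c c0) => //.
  exact: mulfI.
apply: eq_null (nullD mul add) => a; ring.
Qed.

(** By invariance, f has asymptotically the same average as each of its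
    substitutions f (c y * a + h y), hence as their average over any finite set
    of parameters y, which can be made small by van der Corput. *)
Lemma null_vdc (d : nat) (c h : K -> K) (f : K -> C) (e : {poly K}) :
    (forall a, `|f a| <= 1) -> e != 0 -> (forall y, e.[y] != 0 -> c y != 0) ->
  vdc_null F d (fun y a => f (c y * a + h y)) -> null F f.
Proof.
move=> f1 e0 ce fv eps eps0; have eps20 : 0 < eps / 2 by rewrite divr_gt0.
have [||Y [Y0 eY HY]] := @vdc_null_small_means R K F K_infinite d unit predT
   (fun _ y a => f (c y * a + h y)) _ _ e (eps / 2) e0 eps20 => //.
have near_f : \forall k \near \oo, forall y, y \in Y ->
    `|mean (F k) (fun a => f (c y * a + h y) - f a)| <= eps / 2.
  apply: near_all_seq => y yY.
  exact: null_affine (ce _ (eY _ yY)) f1 _ eps20.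
apply: filterS2 near_f (HY tt isT) => k near_f small.
have -> : mean (F k) f =
    mean (F k) (fun a => mean Y (fun y => f (c y * a + h y))) -
    mean Y (fun y => mean (F k) (fun a => f (c y * a + h y) - f a)).
  rewrite exchange_mean -meanB -[LHS](mean_cst _ Y0); apply: eq_mean => y.
  by rewrite meanB subKr.
apply: (le_trans (ler_normB _ _)); rewrite [leRHS]splitr lerD //.
by apply: norm_mean_le => //; apply: ltW.
Qed.

(** The translates of the singleton 0 are pairwise disjoint, so that already one
    differencing of the family of translates gives the zero function. *)
Lemma null_indicator0 : null F (fun a => (a == 0)%:R : C).
Proof.
apply: (@null_vdc 1 (fun=> 1) id _ 1).
- by move=> a; rewrite normr_nat lern1 leq_b1.
- exact: oner_neq0.
- by move=> *; apply: oner_neq0.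
exists 'X; rewrite ?polyX_eq0 // => t t' tt'.
exists 1; rewrite ?oner_eq0 // => y _ e e0; apply: nearW => k.
rewrite /mean big1 ?mulr0 ?normr0 ?ltW // => a _; rewrite conjC_nat -natrM.
case: eqP => [at0|]; last by rewrite mul0n.
case: eqP => [at0'|]; last by rewrite muln0.
move: tt'; rewrite hornerX subr_eq0 => /eqP[].
by apply: (addrI (1 * a + y)); rewrite -!addrA at0 at0'.
Qed.

Lemma null_off0 (f g : K -> C) : (forall a, a != 0 -> f a = g a) ->
  null F f -> null F g.
Proof.
move=> fg nf; have := nullD nf (nullZ (g 0 - f 0) null_indicator0).
apply: eq_null => a; have [->|a0] := eqVneq a 0.
  by rewrite mulr1; ring.
by rewrite mulr0 addr0 fg.
Qed.

(** A translation by h multiplies the averages of chi by chi h, yet changes them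
    by o(1), and chi h <> 1 for some h. *)
Lemma null_additive_character (chi : K -> C) :
  additive_character chi -> chi <> (fun=> 1) -> null F chi.
Proof.
move=> [chi1 chiD] chi_neq1.
have [h h1] : exists h, chi h != 1.
  apply: contrapT => /forallNP chiN; apply: chi_neq1; apply/funext => h.
  by apply/eqP/negPn/negP/chiN.
have chi_le1 a : `|chi a| <= 1 by have := chi1 a; rewrite /unit_circle /= => ->.
have := nullZ (chi h - 1)^-1 (null_affine h (oner_neq0 _) chi_le1).
apply: eq_null => a; rewrite mul1r chiD; field.
by rewrite subr_eq0.
Qed.

End Invariance.

(** * Poles, polynomials and characters *)

Section Polar.
Variable K : fieldType.

(** The rational functions p / q with a pole in K; the witness z of the pole is
    what survives differencing, in any characteristic. *)
Definition polar (rho : K -> K) := exists p q : {poly K}, exists z : K,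
  [/\ q != 0, q.[z] = 0, p.[z] != 0 &
      forall y, q.[y] != 0 -> rho y * q.[y] = p.[y]].

Lemma polar_inverse_power m : (0 < m)%N -> polar (fun y => y ^- m).
Proof.
move=> m0; exists 1, 'X^m, 0; split; rewrite ?monic_neq0 ?monicXn //.
- by rewrite hornerXn expr0n gtn_eqF.
- by rewrite hornerC oner_neq0.
- by move=> y; rewrite hornerXn hornerC => ?; rewrite mulVf.
Qed.

Lemma polar_neq0 rho : polar rho ->
  exists2 e : {poly K}, e != 0 & forall y, e.[y] != 0 -> rho y != 0.
Proof.
move=> [p [q [z [q0 qz pz rhoE]]]]; exists (p * q).
  by rewrite mulf_neq0 //; apply: contraNneq pz => ->; rewrite horner0.
move=> y; rewrite hornerM mulf_eq0 negb_or => /andP[py qy].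
by apply: contraNneq py => rho0; rewrite -rhoE // rho0 mul0r.
Qed.

(** If rho has a pole at z, the difference has a pole at z - t, coming from its
    first term, unless the second one also has a pole there, that is, unless q
    vanishes at z + (t' - t). *)
Lemma polar_difference rho : polar rho ->
  exists2 e : {poly K}, e != 0 & forall t t', e.[t' - t] != 0 ->
    polar (fun y => rho (y + t) - rho (y + t')).
Proof.
move=> [p [q [z [q0 qz pz rhoE]]]]; exists (q \Po ('X + z%:P)).
  exact: comp_XaddC_neq0.
move=> t t' qt.
pose sh (f : {poly K}) u := f \Po ('X + u%:P).
have shE f u y : (sh f u).[y] = f.[y + u] by rewrite horner_comp !hornerE.
exists (sh p t * sh q t' - sh p t' * sh q t), (sh q t * sh q t'), (z - t).
split.
- by rewrite mulf_neq0 ?comp_XaddC_neq0.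
- by rewrite hornerM shE subrK qz mul0r.
- rewrite !(hornerD, hornerN, hornerM, shE) subrK qz mulr0 subr0 mulf_neq0 //.
  by move: qt; rewrite horner_comp !hornerE addrC addrA addrAC.
- move=> y; rewrite !(hornerD, hornerN, hornerM, shE) mulf_eq0 negb_or.
  move=> /andP[qy qy'].
  by rewrite -!rhoE //; ring.
Qed.

(** Both translates have the leading coefficient of p. *)
Lemma size_poly_difference d (p : {poly K}) (t t' : K) : (size p <= d.+1)%N ->
  (size ((p \Po ('X + t%:P)) - (p \Po ('X + t'%:P)))%R <= d)%N.
Proof.
move=> pd; have szE u : size (p \Po ('X + u%:P)) = size p.
  by rewrite size_comp_poly2 // size_XaddC.
have ledE u : (p \Po ('X + u%:P))`_d = p`_d.
  move: pd; rewrite leq_eqVlt => /predU1P[pd|pd].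
    have := @lead_coef_comp _ p ('X + u%:P); rewrite size_XaddC => /(_ isT).
    by rewrite lead_coefXaddC expr1n mulr1 !lead_coefE szE pd.
  by rewrite !nth_default ?szE.
apply/leq_sizeP => j; rewrite coefB leq_eqVlt => /predU1P[<-|dj].
  by rewrite !ledE subrr.
by rewrite !nth_default ?subrr // szE (leq_trans pd).
Qed.

End Polar.

Section Characters.
Variables (R : realType) (K : fieldType) (chi : K -> R[i]).
Hypothesis chi_char : additive_character chi.

Lemma character_norm x : `|chi x| = 1.
Proof. by have [chi1 _] := chi_char; have := chi1 x. Qed.

Lemma characterD x y : chi (x + y) = chi x * chi y.
Proof. by have [_ ->] := chi_char. Qed.

Lemma character_conj x : (chi x)^* = (chi x)^-1.
Proof. by rewrite invC_norm character_norm expr1n invr1 mul1r. Qed.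

Lemma characterB x y : chi (x - y) = chi x * (chi y)^*.
Proof.
have chi0 : chi y != 0 by rewrite -normr_eq0 character_norm oner_eq0.
by apply: (mulIf chi0); rewrite -characterD subrK character_conj mulfVK.
Qed.

Lemma character0 : chi 0 = 1.
Proof. by rewrite -(subrr 0) characterB -normCK character_norm expr1n. Qed.

End Characters.

Section Phases.
Variables (R : realType) (K : fieldType) (F : nat -> {fset K}).
Local Notation C := R[i].
Hypothesis K_infinite : infinite_set [set: K].
Hypothesis F_Folner : double_Folner R F.
Variables (r : nat) (xi : 'I_r -> K -> C) (b : 'I_r -> K -> K) (top : 'I_r).
Hypothesis xi_char : forall i, additive_character (xi i).
Hypothesis null_leading : forall v : 'I_r -> K, v top != 0 ->
  null F (fun a => \prod_i xi i (v i * b i a)).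

(** Families G of products of characters in which the parameter y enters each
    argument through a polynomial of degree less than d, whose coefficients are
    arbitrary functions of a, plus a remainder rho_i (y) b_i (a). The
    factor c (y) comes out of the averages over a, and w (a) cancels at the first
    differencing. Excluding roots of e and a = 0 leaves room for the poles of
    rho_i and for negative powers of a. *)
Definition phase_form (d : nat) (w : K -> C) (G : K -> K -> C) :=
  exists (c : K -> C) (Q : 'I_r -> K -> {poly K}) (rho : 'I_r -> K -> K)
    (e : {poly K}),
  [/\ e != 0, forall i a, (size (Q i a) <= d)%N, polar (rho top) &
   forall y a, e.[y] != 0 -> a != 0 ->
     G y a = c y * w a * \prod_i xi i ((Q i a).[y] + rho i y * b i a)].

(** Differencing lowers the degree of the polynomial parts, preserves the pole of
    rho_top and, w being unimodular, cancels w. *)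
Lemma phase_form_difference d (w : K -> C) G :
    (forall a, a != 0 -> `|w a| = 1) ->
    phase_form d.+1 w G ->
  exists2 e : {poly K}, e != 0 & forall t t', e.[t' - t] != 0 ->
    phase_form d (fun=> 1) (fun y a => G (y + t) a * (G (y + t') a)^*).
Proof.
move=> w1 [c [Q [rho [e [e0 Qd /polar_difference[e' e'0 rhoP] GE]]]]].
exists e' => // t t' /rhoP rho_polar.
exists (fun y => c (y + t) * (c (y + t'))^*).
exists (fun i a => (Q i a \Po ('X + t%:P)) - (Q i a \Po ('X + t'%:P))).
exists (fun i y => rho i (y + t) - rho i (y + t')).
exists ((e \Po ('X + t%:P)) * (e \Po ('X + t'%:P))); split => //.
- by rewrite mulf_neq0 ?comp_XaddC_neq0.
- by move=> i a; apply: size_poly_difference.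
move=> y a; rewrite hornerM !horner_comp !hornerE mulf_eq0 negb_or.
move=> /andP[et et'] a0; rewrite !GE // !rmorphM /= rmorph_prod.
rewrite [LHS](_ : _ = c (y + t) * (c (y + t'))^* * (w a * (w a)^*) *
  (\prod_i xi i ((Q i a).[y + t] + rho i (y + t) * b i a) *
   \prod_i (xi i ((Q i a).[y + t'] + rho i (y + t') * b i a))^*)); last by ring.
rewrite -normCK w1 // expr1n !mulr1 -big_split /=; congr (_ * _).
apply: eq_bigr => i _; rewrite -characterB //; congr (xi i _).
by rewrite !(hornerE, horner_comp); ring.
Qed.

(** After d differencings the polynomial parts have disappeared, while the
    coefficient rho_top, having a pole, is still generically nonzero: only the
    functions of [null_leading] remain. *)
Lemma phase_form_vdc d G : phase_form d (fun=> 1) G -> vdc_null F d G.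
Proof.
elim: d G => [|d IH] G; last first.
  move=> /phase_form_difference[|e e0 eP]; first by move=> *; rewrite normr1.
  by exists e => // t t' /eP; apply: IH.
move=> [c [Q [rho [e [e0 Qd /polar_neq0[e' e'0 rho0] GE]]]]].
exists (e * e'); first exact: mulf_neq0.
move=> y; rewrite hornerM mulf_eq0 negb_or => /andP[ey /rho0 rhoy].
apply: (null_off0 K_infinite F_Folner) (nullZ (c y) (null_leading rhoy)).
move=> a a0; rewrite GE // mulr1; congr (_ * _); apply: eq_bigr => i _.
have := Qd i a; rewrite leqn0 size_poly_eq0 => /eqP ->.
by rewrite horner0 add0r.
Qed.

Lemma phase_form_twisted_vdc d (w : K -> C) G :
    (forall a, a != 0 -> `|w a| = 1) ->
  phase_form d.+1 w G -> vdc_null F d.+1 G.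
Proof.
move=> w1 /(phase_form_difference w1)[e e0 eP]; exists e => // t t' /eP.
exact: phase_form_vdc.
Qed.

End Phases.

(** * Monomial phases *)

Section Expansion.
Variable K : fieldType.

(** The terms of the binomial expansion of (y^-1 + y^(N-1) y^-1 a)^m, for m <= N,
    other than the constant term y^-m and, when m = N, the linear term
    N a y^-1. *)
Definition expansion_poly (N m : nat) (a : K) : {poly K} :=
  \sum_(j < m.+1 | (0 < j)%N && ~~ ((m == N) && (j == 1 :> nat)))
    (a ^+ j *+ 'C(m, j)) *: 'X^(N.-1 * j - m).

Lemma size_expansion_poly N m a : (size (expansion_poly N m a) <= (N * m).+1)%N.
Proof.
apply: (leq_trans (size_sum _ _ _)); apply/bigmax_leqP => j _.
apply: (leq_trans (size_scale_leq _ _)); rewrite size_polyXn ltnS.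
apply: (leq_trans (leq_subr _ _)); apply: leq_mul; first exact: leq_pred.
by rewrite -ltnS.
Qed.

(** The term of degree j in a carries the power y^((N-1) j - m). For j >= 1 and
    m <= N this exponent is negative only if j = 1 and m = N: the substitution
    a -> (1 + y^(N-1) a) / y puts a pole in y on the linear term of the top
    monomial, and on no other nonconstant term. *)
Lemma affine_power_expansion N m (y a : K) : (0 < N)%N -> (m <= N)%N -> y != 0 ->
  (y ^+ N.-1 / y * a + y^-1) ^+ m =
  y ^- m + ((expansion_poly N m a).[y] +
            y ^- 1 * (if m == N then N%:R * a else 0)).
Proof.
move=> N0 mN y0; rewrite [X in X ^+ m]addrC exprDn.
have termE (j : 'I_m.+1) : y^-1 ^+ (m - j) * (y ^+ N.-1 / y * a) ^+ j =
    y ^+ (N.-1 * j) * y ^- m * a ^+ j.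
  have jm : (j <= m)%N by rewrite -ltnS.
  rewrite !exprMn -exprM -[in y ^- m](subnK jm) exprD invfM !exprVn; ring.
rewrite (bigD1 ord0) // termE /= muln0 !expr0 mul1r mulr1 bin0 mulr1n.
congr (_ + _).
rewrite (bigID (fun j : 'I_m.+1 => (m == N) && (j == 1 :> nat))) /=.
rewrite addrC; congr (_ + _).
  rewrite /expansion_poly horner_sum; apply: eq_big => j.
    by rewrite lt0n -val_eqE.
  rewrite -val_eqE /= => /andP[j0 j1]; rewrite termE hornerZ hornerXn.
  have mj : (m <= N.-1 * j)%N by have := ltn_ord j; case: eqP j1 => /=; nia.
  rewrite -[in LHS](subnK mj) exprD mulfK ?expf_neq0 //.
  by rewrite mulrnAl mulrC.
case: eqP => [mE|_]; last by rewrite big_pred0 ?mulr0 // => j; rewrite andbF.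
have m1 : (1 < m.+1)%N by rewrite mE.
rewrite (big_pred1 (Ordinal m1)) => [|j /=]; last first.
  by rewrite -!val_eqE /=; case: (val j) => [|[|]].
rewrite termE /= muln1 expr1 bin1 mE -[in y ^- N](prednK N0) exprS.
by rewrite -mulr_natl; field; rewrite y0 expf_neq0.
Qed.

End Expansion.

Section Monomials.
Variables (R : realType) (K : fieldType) (F : nat -> {fset K}).
Local Notation C := R[i].
Hypothesis K_infinite : infinite_set [set: K].
Hypothesis F_Folner : double_Folner R F.

Lemma null_scaled_character (chi : K -> C) (s : K) :
    additive_character chi -> chi <> (fun=> 1) -> s != 0 ->
  null F (fun a => chi (s * a)).
Proof.
move=> chi_char chi1 s0; apply: (null_additive_character F_Folner).
  split=> [x|x y]; first exact: character_norm.
  by rewrite mulrDr characterD.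
move=> chis; apply: chi1; apply/funext => x.
by have := congr1 (@^~ (s^-1 * x)) chis; rewrite mulVKf.
Qed.

(** In the expansion of [affine_power_expansion] the polynomial terms are killed
    by differencing in y, and there remains a multiple of the additive character
    xi_top (s N a) with s <> 0, which is nontrivial because N <> 0 in K. *)
Lemma null_monomial_phase r (xi : 'I_r -> K -> C) (n : 'I_r -> nat)
    (top : 'I_r) :
    (forall i, additive_character (xi i)) -> xi top <> (fun=> 1) ->
    (n top)%:R != 0 :> K -> (forall i, i != top -> (n i < n top)%N) ->
  null F (fun a => \prod_i xi i (a ^+ n i)).
Proof.
move=> xi_char xi_top ntop n_lt; set N := n top.
have N0 : (0 < N)%N by rewrite lt0n; apply: contraNneq ntop; rewrite -/N => ->.
have nN i : (n i <= N)%N.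
  by have [->//|/n_lt/ltnW] := eqVneq i top.
apply: (@null_vdc _ _ _ K_infinite F_Folner (N * N).+1
   (fun y => y ^+ N.-1 / y) (fun y => y^-1) _ 'X).
- by move=> a; rewrite normr_prod big1 // => i _; apply: character_norm.
- by rewrite polyX_eq0.
- by move=> y; rewrite hornerX => y0; rewrite mulf_neq0 ?invr_eq0 ?expf_neq0.
apply: (@phase_form_twisted_vdc _ _ _ K_infinite F_Folner r xi
  (fun i a => if n i == N then N%:R * a else 0) top xi_char _ _ (fun=> 1)).
- move=> v vtop.
  have := @null_scaled_character (xi top) (v top * N%:R) (xi_char top) xi_top.
  rewrite mulf_neq0 // => /(_ isT); apply: eq_null => a.
  rewrite (bigD1 top) //= eqxx -mulrA big1 ?mulr1 // => i /n_lt itop.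
  by rewrite ltn_eqF // mulr0 character0.
- by move=> a _; rewrite normr1.
exists (fun y => \prod_i xi i (y ^- n i)), (fun i a => expansion_poly N (n i) a).
exists (fun _ y => y ^- 1), 'X; split.
- by rewrite polyX_eq0.
- move=> i a; apply: (leq_trans (size_expansion_poly _ _ _)).
  by rewrite ltnS leq_mul2l nN orbT.
- exact: polar_inverse_power.
move=> y a; rewrite hornerX => y0 a0; rewrite mulr1 -big_split /=.
apply: eq_bigr => i _; rewrite -characterD //; congr (xi i _).
exact: affine_power_expansion.
Qed.

End Monomials.

Theorem theorem1p22 (R : realType) (K : fieldType)
    (K_countably_infinite : ([set: K] #= [set: nat])%card)
    (r : nat) (n : 'I_r -> int)
    (n_neq0 : forall i, n i != 0)
    (n_ndvd_char : forall p, p \in [pchar K] -> forall i, ~~ (p%:Z %| n i)%Z)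
    (n_distinct : forall i j, 0 < n i -> 0 < n j -> n i = n j -> i = j)
    (I_nonempty : exists i, 0 < n i)
    (F : nat -> {fset K}) (F_Folner : double_Folner R F)
    (xi : 'I_r -> K -> R[i])
    (xi_char : forall i, additive_character (xi i))
    (xi_nontrivial : forall i, 0 < n i -> xi i <> (fun=> 1))
    (eta : K -> R[i]) (eta_char : multiplicative_character eta) :
  ((#|` F k|%:R)^-1 *
     \sum_(a <- (F k `\ 0%R)%fset) eta a * \prod_(i < r) xi i (a ^ n i) : R[i]^o)
    @[k --> \oo] --> (0 : R[i]^o).
Proof.
have K_infinite : infinite_set [set: K].
  by rewrite (eq_finite_set K_countably_infinite); apply: infinite_nat.
have [eta1 etaM] := eta_char.
have [top n_top n_max] : exists2 top, 0 < n top & forall j, n j <= n top.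
  have [i0 i0P] := I_nonempty.
  case: (@arg_maxP _ _ _ i0 predT n isT) => top _ top_max.
  by exists top => [|j]; [apply: lt_le_trans i0P (top_max i0 isT)|apply: top_max].
pose f a := if a == 0 then 0 else eta a * \prod_(i < r) xi i (a ^ n i).
have f1 a : `|f a| <= 1.
  rewrite /f; case: eqVneq => [_|a0]; first by rewrite normr0.
  rewrite normrM (eta1 a a0) mul1r normr_prod big1 // => i _.
  exact: character_norm.
suff nf : null F f.
  apply/cvgr0Pnorm_le => e e0; apply: filterS (nf e e0) => k.
  congr (`|_| <= _); congr (_ * _).
  rewrite /f (eq_bigr (fun a => if a != 0 then
    eta a * \prod_(i < r) xi i (a ^ n i) else 0)) => [|a _]; last by case: eqP.
  rewrite -big_mkcond big_fset_condE /=; apply: congr_big => //.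
  by congr enum_fset; apply/fsetP => x; rewrite !inE andbC.
(* Under a -> a / y, negative powers of a become polynomial in y, positive ones
   get a pole at y = 0, and eta splits as eta (1 / y) eta (a). *)
pose N := (\max_i `|n i|)%N.
apply: (@null_vdc _ _ _ K_infinite F_Folner N.+1 (fun y => y^-1)
  (fun=> 0) f 'X) => //.
- by rewrite polyX_eq0.
- by move=> y; rewrite hornerX invr_eq0.
apply: (@phase_form_twisted_vdc _ _ _ K_infinite F_Folner r xi
  (fun i a => if 0 < n i then a ^+ `|n i| else 0) top xi_char _ _ eta)
  => [v vtop||].
(* The exponents n_i < 0 are carried along as the trivial character of a ^ 0. *)
- pose xi' i x := if 0 < n i then xi i (v i * x) else 1.
  pose n' i := if 0 < n i then `|n i|%N else 0%N.
  have n'_top : n' top = `|n top|%N by rewrite /n' n_top.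
  apply: (@eq_null _ _ _ (fun a => \prod_i xi' i (a ^+ n' i))) => [a|].
    apply: eq_bigr => i _; rewrite /xi' /n' /=.
    by case: (0 < n i); rewrite ?mulr0 ?character0.
  apply: (@null_monomial_phase _ _ _ K_infinite F_Folner _ _ _ top)
    => [i|||i itop].
  - rewrite /xi'; case: (0 < n i); last first.
      by split=> [x|x y]; rewrite /unit_circle /= ?normr1 ?mulr1.
    split=> [x|x y]; first exact: character_norm.
    by rewrite mulrDr characterD.
  - rewrite /xi' n_top => xi1; apply: (xi_nontrivial _ n_top); apply/funext => x.
    by have := congr1 (@^~ ((v top)^-1 * x)) xi1; rewrite mulVKf.
  - rewrite n'_top; apply/negP => ntop0.
    have ntop_gt0 : (0 < `|n top|)%N by rewrite absz_gt0 n_neq0.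
    have [p pK] := natf0_pchar ntop_gt0 ntop0.
    by have := n_ndvd_char p pK top; rewrite dvdzE /= (dvdn_pcharf pK) ntop0.
  - rewrite n'_top /n'; case: ifP => [ni|_]; last by rewrite absz_gt0 n_neq0.
    rewrite -ltz_nat !gtz0_abs // lt_neqAle n_max andbT.
    by apply: contra itop => /eqP /(n_distinct _ _ ni n_top) ->.
- exact: eta1.
exists (fun y => eta y^-1).
exists (fun i a => if 0 < n i then 0 else a ^ n i *: 'X^`|n i|).
exists (fun i y => y ^- `|n i|), 'X; split.
- by rewrite polyX_eq0.
- move=> i a; case: ifP => _; first by rewrite size_poly0.
  apply: (leq_trans (size_scale_leq _ _)); rewrite size_polyXn ltnS.
  exact: (leq_bigmax i).
- by apply: polar_inverse_power; rewrite absz_gt0 n_neq0.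
move=> y a; rewrite hornerX addr0 => y0 a0.
rewrite /f mulf_eq0 invr_eq0 (negPf y0) (negPf a0) /= etaM ?invr_eq0 //.
congr (_ * _); apply: eq_bigr => i _; congr (xi i _).
case: (n i) (n_neq0 i) => m m0 /=.
  by rewrite ltz_nat lt0n m0 horner0 add0r -!exprnP exprMn exprVn.
rewrite mulr0 addr0 hornerZ hornerXn NegzE -!exprnN.
by rewrite exprMn exprVn invfM invrK mulrC.
Qed.
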